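(* Let $\mathbb{K}$ be a field, $I$ and $J$ index sets, $J_0\subseteq J$, $\overline{J_0}=J\setminus J_0$, and let $R_j\in\mathbb{K}\langle X_i, i\in I\rangle$ ($j\in J$) be monic with respect to a fixed admissible order on the free monoid $\mathcal{M}$ of monomials in the $X_i$. Let $\mathbb{A}$, $\mathbb{A}^{c,J_0}$, $\mathcal{Z}$, $\overline{R}_j\in\mathcal{Z}$ and $\mathbb{A}^{z,J_0}=\mathcal{Z}\langle X_i, i\in I\mid R_j=\overline{R}_j, j\in J\rangle$ be as defined in the context. Suppose that the presentation $\mathbb{A}=\mathbb{K}\langle X_i, i\in I\mid R_j=0, j\in J\rangle$ is a Gröbner-Shirshov basis. Then the presentation $\mathbb{A}^{z,J_0}=\mathcal{Z}\langle X_i, i\in I\mid R_j=\overline{R}_j, j\in J\rangle$ is a Gröbner-Shirshov basis (over $\mathcal{Z}$) if and only if for each composition $R_j\circ_b R_k$ (where $\mathfrak{d}(R_j)=ab$, $\mathfrak{d}(R_k)=bc$, $a,b,c\in\mathcal{M}$, $b\neq 1$) one of its obstacles can be written as $$\mathrm{Obs}(R_j\circ_b R_k)=\sum_{s=1}^m \gamma_s\, u_s\,(R_{l_s}-\overline{R}_{l_s})\,v_s\ \in\ \mathcal{Z}\langle X_i\rangle$$ for some $\gamma_s\in\mathcal{Z}$, $u_s,v_s\in\mathcal{M}$, $l_s\in J$ with $abc\succ u_s\,\mathfrak{d}(R_{l_s})\,v_s$ for all $s$.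
   Context: Algebras. $\mathbb{A}=\mathbb{K}\langle X_i, i\in I\mid R_j=0, j\in J\rangle$ is the associative unital $\mathbb{K}$-algebra with the given generators and relations. Its partial centrification is $$\mathbb{A}^{c,J_0}=\mathbb{K}\langle X_i, i\in I\mid X_iR_j=R_jX_i,\ (i,j)\in I\times J_0;\ R_j=0,\ j\in\overline{J_0}\rangle .$$ $\overline{R}_j$ is the image of $R_j$ in $\mathbb{A}^{c,J_0}$ (so $\overline{R}_j=0$ for $j\in\overline{J_0}$), and $\mathcal{Z}$ is the (commutative, central) $\mathbb{K}$-subalgebra of $\mathbb{A}^{c,J_0}$ generated by the $\overline{R}_j$, $j\in J_0$. $\mathbb{A}^{z,J_0}$ is the $\mathcal{Z}$-algebra with generators $X_i$ and relations $R_j-\overline{R}_j=0$, $j\in J$, where $R_j$ is viewed in the free algebra $\mathcal{Z}\langle X_i\rangle$ by extension of scalars and $\overline{R}_j\in\mathcal{Z}$ is a scalar. Orders. $\mathcal{M}$ is the free monoid on the $X_i$ with an admissible order $\succeq$ (a well-order compatible with left and right multiplication, for which $1$ is the least element; e.g. deg-lex). $\mathfrak{d}(f)$ denotes the leading monomial of $f$. All $R_j$ are monic, i.e. the coefficient of $\mathfrak{d}(R_j)$ in $R_j$ is $1$. Gröbner-Shirshov bases. Let $T$ be a commutative ring and $f_j\in T\langle X_i\rangle$ ($j\in J$) monic. For $j,k\in J$ and $a,b,c\in\mathcal{M}$ with $\mathfrak{d}(f_j)=ab$, $\mathfrak{d}(f_k)=bc$, $b\ne 1$, the composition is $f_j\circ_b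 f_k=f_jc-af_k$. The presentation $T\langle X_i\mid f_j=0, j\in J\rangle$ is called a Gröbner-Shirshov basis if no $\mathfrak{d}(f_j)$ contains $\mathfrak{d}(f_k)$, $k\ne j$, as a subword and every composition can be written as $f_j\circ_b f_k=\sum_{i}\beta_i u_i f_{l_i}v_i$ (finite sum) with $\beta_i\in T$, $u_i,v_i\in\mathcal{M}$, $l_i\in J$ and $abc\succ u_i\mathfrak{d}(f_{l_i})v_i$ for all $i$. For the presentation of $\mathbb{A}^{z,J_0}$ one takes $T=\mathcal{Z}$, $f_j=R_j-\overline{R}_j$, with leading monomials $\mathfrak{d}(R_j)$. Obstacles. Given a composition of the presentation of $\mathbb{A}$ and any expression $R_j\circ_bR_k=R_jc-aR_k=\sum_{i=1}^n\beta_iu_iR_{l_i}v_i$ with $\beta_i\in\mathbb{K}$, $u_i,v_i\in\mathcal{M}$ and $abc\succ u_i\mathfrak{d}(R_{l_i})v_i$, the corresponding obstacle is $$\mathrm{Obs}(R_j\circ_bR_k)=\overline{R}_k\,a-\overline{R}_j\,c+\sum_{i=1}^n\beta_i\,\overline{R}_{l_i}\,u_iv_i\in\mathcal{Z}\langle X_i\rangle .$$ It depends on the chosen expression, so a composition may have several obstacles. *)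

(* Defs.v *)
From HB Require Import structures.
From mathcomp Require Import all_boot all_order all_algebra.
From mathcomp Require Import generic_quotient ring_quotient.
From mathcomp Require Import finmap.
From mathcomp Require Import boolp classical_sets.
From mathcomp.multinomials Require Import monalg.

Set Implicit Arguments.
Unset Strict Implicit.
Unset Printing Implicit Defensive.

Import GRing.Theory.

Notation "1" := (@mone _) : monom_scope.
Notation "u * v" := (mmul u v) : monom_scope.

Local Open Scope fset_scope.
Local Open Scope classical_set_scope.
Local Open Scope ring_scope.

(* [T<X_i, i in I>] has the carrier [{malg T[{fmonom I}]}] of multinomials, but
the ring structure of multinomials requires [1 != 0] in [T].  Here [T] can be
the zero ring (the algebra Z below is zero when the partial centrification
is), so the ring structure is rebuilt over an arbitrary [comPzRingType]. *)

Definition freeAlg (T : comPzRingType) (I : choiceType) : Type :=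
  {malg T[{fmonom I}]}.

HB.instance Definition _ (T : comPzRingType) (I : choiceType) :=
  GRing.Zmodule.on (freeAlg T I).

HB.lock Definition fscale (T : comPzRingType) (I : choiceType) (c : T)
    (g : freeAlg T I) : freeAlg T I :=
  \sum_(k <- msupp g) << c * g@_k *g k >>.

HB.lock Definition fmul (T : comPzRingType) (I : choiceType)
    (f g : freeAlg T I) : freeAlg T I :=
  \sum_(k1 <- msupp f) \sum_(k2 <- msupp g) << f@_k1 * g@_k2 *g (k1 * k2)%M >>.

Section FreeAlg.
Variables (T : comPzRingType) (I : choiceType).
Local Notation M := {fmonom I}.
Local Notation F := (freeAlg T I).
Local Notation fscale := (@fscale T I).
Local Notation fmul := (@fmul T I).
Implicit Types (f g : F) (c : T) (m : M).

Definition mon m : F := << 1 *g m >>.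
Definition gen (i : I) : F := mon (fmu i).
Definition scal c : F := << c *g 1%M >>.

Lemma fscaleE c g k : (fscale c g)@_k = c * g@_k.
Proof.
rewrite {2}[g]monalgE fscale.unlock.
rewrite !(raddf_sum (mcoeff k)) mulr_sumr.
by apply/eq_bigr=> /= i _; rewrite !mcoeffU mulrnAr.
Qed.

Lemma fscaleA c1 c2 g : fscale c1 (fscale c2 g) = fscale (c1 * c2) g.
Proof. by apply/malgP=> x; rewrite !fscaleE mulrA. Qed.

Lemma fscale1r : left_id 1 fscale.
Proof. by move=> g; apply/malgP=> k; rewrite fscaleE mul1r. Qed.

Lemma fscaleDr : right_distributive fscale +%R.
Proof. by move=> c f g; apply/malgP=> k; rewrite !(mcoeffD, fscaleE) mulrDr. Qed.

Lemma fscaleDl g : {morph fscale^~ g : c1 c2 / c1 + c2}.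
Proof. by move=> c1 c2; apply/malgP=> k; rewrite !(mcoeffD, fscaleE) mulrDl. Qed.

HB.instance Definition _ := GRing.Zmodule_isLmodule.Build T F
  fscaleA fscale1r fscaleDr fscaleDl.

Lemma fmullw (d1 d2 : {fset M}) f g :
  (msupp f `<=` d1)%fset -> (msupp g `<=` d2)%fset ->
  fmul f g = \sum_(k1 <- d1) \sum_(k2 <- d2) << f@_k1 * g@_k2 *g (k1 * k2)%M >>.
Proof.
move=> le_d1 le_d2; rewrite fmul.unlock (big_fset_incl _ le_d1) /=.
  apply/eq_bigr=> k1 _; apply/big_fset_incl => // k _ /mcoeff_outdom ->.
  by rewrite mulr0 monalgU0.
move=> k _ /mcoeff_outdom g1k.
by rewrite big1 => // k' _; rewrite g1k mul0r monalgU0.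
Qed.

Lemma fmulDl : left_distributive fmul +%R.
Proof.
move=> f1 f2 g; set d := (msupp f1 `|` msupp f2)%fset.
rewrite (@fmullw d (msupp g) (f1 + f2)) ?(msuppD_le _ _) ?fsubset_refl //.
rewrite (@fmullw d (msupp g) f1) ?fsubsetUl ?fsubset_refl //.
rewrite (@fmullw d (msupp g) f2) ?fsubsetUr ?fsubset_refl //.
rewrite -big_split /=; apply/eq_bigr=> k1 _.
rewrite -big_split /=; apply/eq_bigr=> k2 _.
by rewrite mcoeffD mulrDl monalgUD.
Qed.

Lemma fmulDr : right_distributive fmul +%R.
Proof.
move=> f g1 g2; set d := (msupp g1 `|` msupp g2)%fset.
rewrite (@fmullw (msupp f) d f (g1 + g2)) ?(msuppD_le _ _) ?fsubset_refl //.
rewrite (@fmullw (msupp f) d f g1) ?fsubsetUl ?fsubset_refl //.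
rewrite (@fmullw (msupp f) d f g2) ?fsubsetUr ?fsubset_refl //.
rewrite -big_split /=; apply/eq_bigr=> k1 _.
rewrite -big_split /=; apply/eq_bigr=> k2 _.
by rewrite mcoeffD mulrDr monalgUD.
Qed.

Lemma fmul0g g : fmul 0 g = 0.
Proof. by rewrite fmul.unlock msupp0 big_seq_fset0. Qed.

Lemma fmulg0 g : fmul g 0 = 0.
Proof. by rewrite fmul.unlock big1 // => k _; rewrite msupp0 big_seq_fset0. Qed.

Lemma fmulUU c1 c2 (k1 k2 : M) :
  fmul << c1 *g k1 >> << c2 *g k2 >> = << c1 * c2 *g (k1 * k2)%M >>.
Proof. by rewrite (fmullw msuppU_le msuppU_le) !big_seq_fset1 !mcoeffUU. Qed.

Lemma fmulEl1 f g :
  fmul f g = \sum_(k1 <- msupp f) fmul << f@_k1 *g k1 >> g.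
Proof.
rewrite {1}fmul.unlock; apply/eq_bigr=> k _.
rewrite (fmullw msuppU_le (fsubset_refl _)) big_seq_fset1.
by apply/eq_bigr => k' _; rewrite mcoeffUU.
Qed.

Lemma fmulEr1 f g :
  fmul f g = \sum_(k2 <- msupp g) fmul f << g@_k2 *g k2 >>.
Proof.
rewrite {1}fmul.unlock exchange_big; apply/eq_bigr=> k _.
rewrite (fmullw (fsubset_refl _) msuppU_le).
by apply/eq_bigr => k' _; rewrite big_seq_fset1 mcoeffUU.
Qed.

Lemma fmul1g : left_id (mon 1%M) fmul.
Proof.
move=> g; rewrite (fmullw msuppU_le (fsubset_refl _)) big_seq_fset1 [RHS]monalgE.
by apply/eq_bigr=> k _; rewrite mcoeffUU mul1r mul1m.
Qed.

Lemma fmulg1 : right_id (mon 1%M) fmul.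
Proof.
move=> g; rewrite (fmullw (fsubset_refl _) msuppU_le) [RHS]monalgE.
by apply/eq_bigr=> k _; rewrite big_seq_fset1 mcoeffUU mulr1 mulm1.
Qed.

Lemma fmul_suml (A : Type) (r : seq A) (h : A -> F) g :
  fmul (\sum_(i <- r) h i) g = \sum_(i <- r) fmul (h i) g.
Proof. by rewrite (big_morph (fmul^~ g) (fun x y => fmulDl x y g) (fmul0g g)). Qed.

Lemma fmul_sumr (A : Type) (r : seq A) (h : A -> F) f :
  fmul f (\sum_(i <- r) h i) = \sum_(i <- r) fmul f (h i).
Proof. by rewrite (big_morph (fmul f) (fmulDr f) (fmulg0 f)). Qed.

Lemma fmulA : associative fmul.
Proof.
move=> g1 g2 g3.
rewrite (fmulEl1 g1 (fmul g2 g3)) (fmulEl1 g1 g2) fmul_suml.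
apply/eq_bigr=> k1 _; set u1 := << _ *g k1 >>.
rewrite (fmulEl1 g2 g3) (fmulEr1 u1 g2) fmul_suml fmul_sumr.
apply/eq_bigr=> k2 _; set u2 := << _ *g k2 >>.
rewrite (fmulEr1 u2 g3) (fmulEr1 (fmul u1 u2) g3) fmul_sumr.
by apply/eq_bigr=> k3 _; rewrite !fmulUU mulrA mulmA.
Qed.

HB.instance Definition _ := GRing.Zmodule_isPzRing.Build F
  fmulA fmul1g fmulg1 fmulDl fmulDr.

Lemma scal_mul c f : scal c * f = c *: f.
Proof.
rewrite [LHS](fmullw msuppU_le (fsubset_refl _)) big_seq_fset1.
rewrite -[RHS]/(fscale c f) fscale.unlock.
by apply/eq_bigr=> k _; rewrite mcoeffUU mul1m.
Qed.

Lemma mul_scal c f : f * scal c = c *: f.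
Proof.
rewrite [LHS](fmullw (fsubset_refl _) msuppU_le).
rewrite -[RHS]/(fscale c f) fscale.unlock.
by apply/eq_bigr=> k _; rewrite big_seq_fset1 mcoeffUU mulm1 mulrC.
Qed.

Lemma fscaleAl c f g : c *: (f * g) = (c *: f) * g.
Proof. by rewrite -!scal_mul mulrA. Qed.

Lemma fscaleAr c f g : c *: (f * g) = f * (c *: g).
Proof. by rewrite -!mul_scal mulrA. Qed.

Lemma monM (m1 m2 : M) : mon (m1 * m2)%M = mon m1 * mon m2.
Proof. by rewrite [RHS]fmulUU mulr1. Qed.

Lemma freeAlgE f : f = \sum_(m <- msupp f) f@_m *: mon m.
Proof.
rewrite [LHS]monalgE; apply/eq_bigr => m _; apply/malgP => k.
by rewrite fscaleE !mcoeffU mulrnAr mulr1.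
Qed.

Lemma freeAlg_ind (P : F -> Prop) :
  P 1 -> (forall i f, P f -> P (gen i * f)) ->
  (forall c f, P f -> P (c *: f)) -> P 0 ->
  (forall f g, P f -> P g -> P (f + g)) -> forall f, P f.
Proof.
move=> P1 PX PZ P0 PD f; rewrite [f]freeAlgE.
apply: big_ind => // m _; apply: PZ; case: m => s.
elim: s => [|i s IHs]; first by rewrite -fmoneE.
suff -> : FMonom (i :: s) = (fmu i * FMonom s)%M by rewrite monM; apply: PX.
by apply: val_inj; rewrite /= fmM fmU.
Qed.

End FreeAlg.

HB.lock Definition base_change (T T' : comPzRingType) (I : choiceType) (phi : T -> T')
    (f : freeAlg T I) : freeAlg T' I :=
  \sum_(m <- msupp f) << phi f@_m *g m >>.

Inductive in_ideal (A : pzRingType) (S : set A) : set A :=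
| ideal_gen x of S x : in_ideal S x
| ideal0 : in_ideal S 0
| idealB x y of in_ideal S x & in_ideal S y : in_ideal S (x - y)
| idealM x y z of in_ideal S y : in_ideal S (x * y * z).

Definition ideal_pred (A : pzRingType) (S : set A) : {pred A} :=
  fun x => `[< in_ideal S x >].

Section IdealPred.
Variables (A : pzRingType) (S : set A).

Lemma ideal_predP x : reflect (in_ideal S x) (x \in ideal_pred S).
Proof. exact: asboolP. Qed.

Fact ideal_pred_zmod_closed : zmod_closed (ideal_pred S).
Proof.
split=> [|x y /ideal_predP Sx /ideal_predP Sy]; apply/ideal_predP.
  exact: ideal0.
exact: idealB.
Qed.

HB.instance Definition _ :=
  GRing.isZmodClosed.Build A (ideal_pred S) ideal_pred_zmod_closed.

Lemma ideal_pred_mul x y z : y \in ideal_pred S -> x * y * z \in ideal_pred S.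
Proof. by move=> /ideal_predP Sy; apply/ideal_predP/idealM. Qed.
End IdealPred.

(* T<X_i, i in I | g = 0, g in rels>; MathComp's algType excludes the zero
   ring, so only the ring and the T-module structures are declared. *)
Definition presAlg (T : comPzRingType) (I : choiceType)
    (rels : set (freeAlg T I)) : Type :=
  Quotient.quot (ideal_pred rels).

HB.instance Definition _ (T : comPzRingType) (I : choiceType)
  (rels : set (freeAlg T I)) := GRing.Zmodule.on (presAlg rels).

Section PresAlg.
Local Open Scope quotient_scope.
Variables (T : comPzRingType) (I : choiceType) (rels : set (freeAlg T I)).
Local Notation F := (freeAlg T I).
Local Notation Q := (Quotient.quot (ideal_pred rels)).
Local Notation B := (presAlg rels).

Definition pres_pi (f : F) : B := \pi_Q f.
Definition pres_repr (x : B) : F := repr (x : Q).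

Lemma pres_reprK : cancel pres_repr pres_pi.
Proof. by move=> x; rewrite /pres_pi /pres_repr reprK. Qed.

Lemma pres_piP f g : reflect (in_ideal rels (f - g)) (pres_pi f == pres_pi g).
Proof. by rewrite -[_ == _]Quotient.idealrBE; apply: ideal_predP. Qed.

Lemma pres_pi0 : pres_pi 0 = 0.
Proof. exact: (raddf0 \pi_Q). Qed.

Lemma pres_piB : {morph pres_pi : f g / f - g}.
Proof. exact: (raddfB \pi_Q). Qed.

Lemma pres_piD : {morph pres_pi : f g / f + g}.
Proof. exact: (raddfD \pi_Q). Qed.

Lemma pres_pi_reprB f : in_ideal rels (f - pres_repr (pres_pi f)).
Proof. by apply/pres_piP; rewrite pres_reprK. Qed.

Lemma in_idealD (f g : F) :
  in_ideal rels f -> in_ideal rels g -> in_ideal rels (f + g).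
Proof. by move=> /ideal_predP Jf /ideal_predP Jg; apply/ideal_predP/rpredD. Qed.

Definition pres_one : B := pres_pi 1.
Definition pres_mul (x y : B) : B := pres_pi (pres_repr x * pres_repr y).
Definition pres_scale (c : T) (x : B) : B := pres_pi (c *: pres_repr x).

Lemma pres_piM f g : pres_pi (f * g) = pres_mul (pres_pi f) (pres_pi g).
Proof.
apply/eqP/pres_piP; set f' := pres_repr _; set g' := pres_repr _.
have -> : f * g - f' * g' = 1 * (f - f') * g + f' * (g - g') * 1.
  by rewrite mul1r mulr1 mulrBl mulrBr addrA subrK.
by apply: in_idealD; apply: idealM; apply: pres_pi_reprB.
Qed.

Lemma pres_piZ c f : pres_pi (c *: f) = pres_scale c (pres_pi f).
Proof.
apply/eqP/pres_piP; rewrite -scalerBr -scal_mul -[_ * _]mulr1.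
exact/idealM/pres_pi_reprB.
Qed.

Fact pres_mulA : associative pres_mul.
Proof.
move=> x y z; rewrite -[x]pres_reprK -[y]pres_reprK -[z]pres_reprK.
by rewrite -!pres_piM mulrA.
Qed.
Fact pres_mul1 : left_id pres_one pres_mul.
Proof. by move=> x; rewrite -[x]pres_reprK -pres_piM mul1r. Qed.
Fact pres_mulr1 : right_id pres_one pres_mul.
Proof. by move=> x; rewrite -[x]pres_reprK -pres_piM mulr1. Qed.
Fact pres_mulDl : left_distributive pres_mul +%R.
Proof.
move=> x y z; rewrite -[x]pres_reprK -[y]pres_reprK -[z]pres_reprK.
by rewrite -pres_piD -!pres_piM -pres_piD mulrDl.
Qed.
Fact pres_mulDr : right_distributive pres_mul +%R.
Proof.
move=> x y z; rewrite -[x]pres_reprK -[y]pres_reprK -[z]pres_reprK.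
by rewrite -pres_piD -!pres_piM -pres_piD mulrDr.
Qed.

HB.instance Definition _ := GRing.Zmodule_isPzRing.Build B
  pres_mulA pres_mul1 pres_mulr1 pres_mulDl pres_mulDr.

Fact pres_scaleA a b x : pres_scale a (pres_scale b x) = pres_scale (a * b) x.
Proof. by rewrite -[x]pres_reprK -!pres_piZ scalerA. Qed.
Fact pres_scale1 : left_id 1 pres_scale.
Proof. by move=> x; rewrite -[x]pres_reprK -pres_piZ scale1r. Qed.
Fact pres_scaleDr : right_distributive pres_scale +%R.
Proof.
move=> c x y; rewrite -[x]pres_reprK -[y]pres_reprK.
by rewrite -pres_piD -!pres_piZ -pres_piD scalerDr.
Qed.
Fact pres_scaleDl x : {morph pres_scale^~ x : a b / a + b}.
Proof.
move=> a b /=; rewrite -[x]pres_reprK.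
by rewrite -!pres_piZ -pres_piD scalerDl.
Qed.

HB.instance Definition _ := GRing.Zmodule_isLmodule.Build T B
  pres_scaleA pres_scale1 pres_scaleDr pres_scaleDl.

Lemma pres_scaleAl (c : T) (x y : B) : c *: (x * y) = (c *: x) * y.
Proof.
rewrite -[x]pres_reprK -[y]pres_reprK.
by rewrite -[LHS]/(pres_scale _ (pres_mul _ _)) -[RHS]/(pres_mul (pres_scale _ _) _)
  -pres_piM -!pres_piZ -pres_piM fscaleAl.
Qed.

Lemma pres_scaleAr (c : T) (x y : B) : c *: (x * y) = x * (c *: y).
Proof.
rewrite -[x]pres_reprK -[y]pres_reprK.
by rewrite -[LHS]/(pres_scale _ (pres_mul _ _)) -[RHS]/(pres_mul _ (pres_scale _ _))
  -pres_piM -!pres_piZ -pres_piM fscaleAr.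
Qed.

Inductive in_subalg (S : set B) : set B :=
| subalg_gen x of S x : in_subalg S x
| subalg1 : in_subalg S 1
| subalgB x y of in_subalg S x & in_subalg S y : in_subalg S (x - y)
| subalgM x y of in_subalg S x & in_subalg S y : in_subalg S (x * y)
| subalgZ (c : T) x of in_subalg S x : in_subalg S (c *: x).

Definition subalg_pred (S : set B) : {pred B} := fun x => `[< in_subalg S x >].

Lemma subalg_predP S x : reflect (in_subalg S x) (x \in subalg_pred S).
Proof. exact: asboolP. Qed.
End PresAlg.

Section Order.
Variables (I : choiceType) (le : rel {fmonom I}).
Local Notation M := {fmonom I}.

Definition mlt (m n : M) : bool := (m != n) && le m n.

Record admissible : Prop := {
  adm_refl : reflexive le;
  adm_anti : antisymmetric le;
  adm_trans : transitive le;
  adm_total : total le;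
  adm_wf : well_founded mlt;
  adm_ge1 : forall m, le 1%M m;
  adm_mul : forall u v m n, le m n -> le (u * m * v)%M (u * n * v)%M
}.

Definition mmax (m n : M) : M := if le m n then n else m.

(* Junk value 1 for f = 0. *)
Definition lead (T : comPzRingType) (f : freeAlg T I) : M :=
  \big[mmax/1%M]_(m <- msupp f) m.

Definition leads (T : comPzRingType) (J : Type) (f : J -> freeAlg T I) : J -> M :=
  fun j => lead (f j).

Definition is_monic (T : comPzRingType) (f : freeAlg T I) : Prop :=
  f@_(lead f) = 1.

End Order.

Section GroebnerShirshov.
Variables (I : choiceType) (J : Type).
Local Notation M := {fmonom I}.

(* The data of a formal sum of terms coef i * lfac i * f_(idx i) * rfac i. *)
Record expr (T : comPzRingType) : Type := Expr {
  len : nat;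
  coef : 'I_len -> T;
  lfac : 'I_len -> M;
  idx : 'I_len -> J;
  rfac : 'I_len -> M
}.

Definition eval_expr (T : comPzRingType) (f : J -> freeAlg T I) (e : expr T) :
    freeAlg T I :=
  \sum_(i < len e) coef i *: (mon T (lfac i) * f (idx i) * mon T (rfac i)).

Variables (le : rel M) (d : J -> M).

Definition expr_below (T : comPzRingType) (w : M) (e : expr T) : Prop :=
  forall i : 'I_(len e), mlt le (lfac i * d (idx i) * rfac i)%M w.

Definition overlap (j k : J) (a b c : M) : Prop :=
  [/\ d j = (a * b)%M, d k = (b * c)%M & b <> 1%M].

Definition composition (T : comPzRingType) (f : J -> freeAlg T I) (j k : J)
    (a c : M) : freeAlg T I :=
  f j * mon T c - mon T a * f k.

(* The leading monomials d are a parameter and not computed from f: the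
   relators R_j - Rbar_j over Z are taken with the leading monomials of the
   R_j, also when Z is zero or R_j is constant. *)
Definition groebner_shirshov (T : comPzRingType) (f : J -> freeAlg T I) : Prop :=
  (forall j k, k <> j -> ~ exists u v, d j = (u * d k * v)%M) /\
  (forall j k a b c, overlap j k a b c ->
    exists e : expr T,
      expr_below (a * b * c)%M e /\ composition f j k a c = eval_expr f e).

End GroebnerShirshov.

Section Centrification.
Variables (K : fieldType) (I : choiceType) (J : Type).
Variables (R : J -> freeAlg K I) (J0 : set J).

Definition centr_rels : set (freeAlg K I) :=
  [set g | exists i, exists2 j, J0 j & g = gen K i * R j - R j * gen K i]
  `|` R @` (~` J0).

Definition centrAlg : Type := presAlg centr_rels.

HB.instance Definition _ := GRing.PzRing.on centrAlg.
HB.instance Definition _ := GRing.Lmodule.on centrAlg.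

Definition Rbar_c (j : J) : centrAlg := pres_pi centr_rels (R j).

Lemma Rbar_c_compl j : ~ J0 j -> Rbar_c j = 0.
Proof.
move=> J0'j; rewrite -[RHS]pres_pi0; apply/eqP/pres_piP.
by rewrite subr0; apply: ideal_gen; right; exists j.
Qed.

Lemma Rbar_c_central j x : J0 j -> Rbar_c j * x = x * Rbar_c j.
Proof.
move=> J0j; rewrite -[x]pres_reprK; elim/freeAlg_ind: (pres_repr x).
- by rewrite -[pres_pi _ 1]/(1 : centrAlg) mulr1 mul1r.
- move=> i f IHf; rewrite pres_piM.
  rewrite -[LHS]/(Rbar_c j * (pres_pi _ (gen K i) * pres_pi _ f)).
  rewrite -[RHS]/(pres_pi _ (gen K i) * pres_pi _ f * Rbar_c j).
  rewrite -mulrA -IHf !mulrA; congr (_ * _).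
  rewrite -[LHS]pres_piM -[RHS]pres_piM; apply/esym/eqP/pres_piP.
  by apply: ideal_gen; left; exists i, j.
- move=> c f IHf; rewrite pres_piZ -[pres_scale _ _]/(c *: _ : centrAlg).
  by rewrite -pres_scaleAl -pres_scaleAr IHf.
- by rewrite pres_pi0 mulr0 mul0r.
by move=> f g IHf IHg; rewrite pres_piD mulrDr mulrDl IHf IHg.
Qed.

Definition Zpred : {pred centrAlg} := @subalg_pred _ _ centr_rels (Rbar_c @` J0).

Lemma Zpred_central z x : z \in Zpred -> z * x = x * z.
Proof.
move/subalg_predP; elim=> {z} [z [j J0j <-]| |y z _ IHy _ IHz|y z _ IHy _ IHz|c z _ IHz].
- exact: Rbar_c_central.
- by rewrite mul1r mulr1.
- by rewrite mulrBl mulrBr IHy IHz.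
- by rewrite -mulrA IHz mulrA IHy mulrA.
by rewrite -pres_scaleAl -pres_scaleAr IHz.
Qed.

Lemma Rbar_c_in_Z j : Rbar_c j \in Zpred.
Proof.
apply/subalg_predP; have [J0j|J0'j] := pselect (J0 j).
  by apply: subalg_gen; exists j.
by rewrite (Rbar_c_compl J0'j) -(subrr 1); apply: subalgB; apply: subalg1.
Qed.

Fact Zpred_subring_closed : subring_closed Zpred.
Proof.
split=> [|x y|x y]; first exact/subalg_predP/subalg1.
  by move=> /subalg_predP Zx /subalg_predP Zy; apply/subalg_predP/subalgB.
by move=> /subalg_predP Zx /subalg_predP Zy; apply/subalg_predP/subalgM.
Qed.

Fact Zpred_submod_closed : GRing.subsemimod_closed Zpred.
Proof.
split; last by move=> c x /subalg_predP Zx; apply/subalg_predP/subalgZ.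
have [B0 BD] : zmod_closed Zpred by exact: GRing.subring_closedB Zpred_subring_closed.
split=> // x y Zx Zy; rewrite -[y]opprK; apply: (BD) => //.
by rewrite -sub0r; apply: BD.
Qed.

(* The algebra Z: the K-subalgebra of the partial centrification generated by
   the Rbar_c j with j in J0. *)
Record Zalg : predArgType := MkZ { Zval : centrAlg; _ : Zval \in Zpred }.

HB.instance Definition _ := [isSub for Zval].
HB.instance Definition _ := [Choice of Zalg by <:].
HB.instance Definition _ :=
  GRing.SubChoice_isSubLmodule.Build K centrAlg Zpred Zalg Zpred_submod_closed.
HB.instance Definition _ :=
  GRing.SubZmodule_isSubPzRing.Build centrAlg Zpred Zalg Zpred_subring_closed.

Fact Zalg_mulC : commutative (@GRing.mul Zalg).
Proof. by move=> x y; apply: val_inj; rewrite !rmorphM; apply/Zpred_central/valP. Qed.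

HB.instance Definition _ := GRing.PzRing_hasCommutativeMul.Build Zalg Zalg_mulC.

Definition Rbar (j : J) : Zalg := MkZ (Rbar_c_in_Z j).

Definition relZ (j : J) : freeAlg Zalg I :=
  base_change (fun c : K => c *: (1 : Zalg)) (R j) - scal I (Rbar j).

Definition obstacle (e : expr I J K) (j k : J) (a c : {fmonom I}) :
    freeAlg Zalg I :=
  Rbar k *: mon Zalg a - Rbar j *: mon Zalg c
  + \sum_(i < len e) (coef i *: Rbar (idx i)) *: mon Zalg (lfac i * rfac i)%M.

End Centrification.

(* Main.v *)
From HB Require Import structures.
Require Import Defs.
From mathcomp Require Import all_boot all_order all_algebra.
From mathcomp Require Import finmap.
From mathcomp Require Import boolp classical_sets.
From mathcomp.multinomials Require Import monalg.

(* Extend an expression of the composition of R_j and R_k to Z and write there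
   R_l = (R_l - Rbar_l) + Rbar_l: the composition of R_j - Rbar_j and
   R_k - Rbar_k becomes the obstacle of that expression plus a combination of
   the R_l - Rbar_l below abc.  Such combinations form a Z-module, so one of
   the two is such a combination exactly when the other is. *)

Set Implicit Arguments.
Unset Strict Implicit.
Unset Printing Implicit Defensive.

Import GRing.Theory.

Local Open Scope ring_scope.

(** The two families of terms are concatenated, with the coefficients of the second multiplied by
    [t]. No monomial changes, so the bound [w] persists. *)
Lemma eval_expr_addZ (I : choiceType) (J : Type) (le : rel {fmonom I})
    (d : J -> {fmonom I}) (T : comPzRingType) (f : J -> freeAlg T I)
    (w : {fmonom I}) (t : T) (e1 e2 : expr I J T) :
  expr_below le d w e1 -> expr_below le d w e2 ->
  exists e : expr I J T, expr_below le d w e /\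
    eval_expr f e1 + t *: eval_expr f e2 = eval_expr f e.
Proof.
move=> lt1 lt2.
(* A family indexed by ['I_(len e1 + len e2)], with the terms of [e1] first. *)
pose glue A (g1 : 'I_(len e1) -> A) (g2 : 'I_(len e2) -> A) i :=
  match split i with inl i1 => g1 i1 | inr i2 => g2 i2 end.
have glueL A g1 g2 i : @glue A g1 g2 (lshift _ i) = g1 i.
  by rewrite /glue (unsplitK (inl i)).
have glueR A g1 g2 i : @glue A g1 g2 (rshift _ i) = g2 i.
  by rewrite /glue (unsplitK (inr i)).
exists (Expr (glue _ (@coef _ _ _ e1) (fun i => t * coef i))
  (glue _ (@lfac _ _ _ e1) (@lfac _ _ _ e2))
  (glue _ (@idx _ _ _ e1) (@idx _ _ _ e2))
  (glue _ (@rfac _ _ _ e1) (@rfac _ _ _ e2))); split=> [i|].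
  by rewrite /= /glue; case: (split i).
rewrite /eval_expr [RHS]big_split_ord scaler_sumr.
apply: (congr2 +%R).
  by apply: eq_bigr => i _; rewrite /= !glueL.
by apply: eq_bigr => i _; rewrite /= !glueR scalerA.
Qed.

Lemma freeAlg_mcoeffZ (T : comPzRingType) (I : choiceType) (t : T)
    (f : freeAlg T I) (m : {fmonom I}) : (t *: f)@_m = t * f@_m.
Proof. exact: fscaleE. Qed.

(** The defining sum runs over the support of [f] only; outside it the coefficient is 0, which
    agrees with [phi f@_m] because [phi 0 = 0]. *)
Lemma base_changeE (T T' : comPzRingType) (I : choiceType) (phi : T -> T')
    (f : freeAlg T I) (m : {fmonom I}) :
  phi 0 = 0 -> (base_change phi f)@_m = phi f@_m.
Proof.
move=> phi0; rewrite base_change.unlock (raddf_sum (mcoeff m)) /=.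
case: (boolP (m \in msupp f)) => fm.
  rewrite (big_fsetD1 m) //= mcoeffUU big1_fset ?addr0 // => k.
  by rewrite !inE => /andP[neq_km _] _; rewrite mcoeffU (negPf neq_km).
rewrite (mcoeff_outdom fm) phi0 big1_fset // => k fk _.
rewrite mcoeffU; case: eqP => // eq_km.
by rewrite eq_km (negPf fm) in fk.
Qed.

Section BaseChange.
Variables (T T' : comPzRingType) (I : choiceType) (phi : {rmorphism T -> T'}).
Local Notation bc := (@base_change T T' I phi).

Lemma base_changeB f g : bc (f - g) = bc f - bc g.
Proof.
by apply/malgP=> m; rewrite !(mcoeffB, base_changeE) ?rmorph0 // rmorphB.
Qed.

Lemma base_changeD f g : bc (f + g) = bc f + bc g.
Proof.
by apply/malgP=> m; rewrite !(mcoeffD, base_changeE) ?rmorph0 // rmorphD.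
Qed.

Lemma base_change_sum (A : Type) (r : seq A) (h : A -> freeAlg T I) :
  bc (\sum_(i <- r) h i) = \sum_(i <- r) bc (h i).
Proof.
apply: (big_morph bc base_changeD).
by apply/malgP=> m; rewrite base_changeE ?mcoeff0 rmorph0.
Qed.

Lemma base_changeZ t f : bc (t *: f) = phi t *: bc f.
Proof.
apply/malgP=> m.
by rewrite base_changeE ?rmorph0 // !freeAlg_mcoeffZ rmorphM base_changeE ?rmorph0.
Qed.

Lemma base_change_mon m : bc (mon T m) = mon T' m.
Proof.
by apply/malgP=> k; rewrite base_changeE ?rmorph0 // !mcoeffU rmorphMn rmorph1.
Qed.

(** By additivity it suffices to compare products of scaled monomials, where only the coefficients
    are moved by [phi]. *)
Lemma base_changeM f g : bc (f * g) = bc f * bc g.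
Proof.
rewrite [f]freeAlgE [g]freeAlgE mulr_suml !base_change_sum mulr_suml.
apply: eq_bigr => m _; rewrite mulr_sumr base_change_sum mulr_sumr.
apply: eq_bigr => n _.
rewrite -fscaleAl -fscaleAr -monM !base_changeZ !base_change_mon.
by rewrite -fscaleAl -fscaleAr -monM.
Qed.

End BaseChange.

Section ScalarsOfZ.
Variables (K : fieldType) (I : choiceType) (J : Type).
Variables (R : J -> freeAlg K I) (J0 : set J).
Local Notation Z := (Zalg R J0).

Lemma Zalg_scaleAl (t : K) (x y : Z) : t *: (x * y) = (t *: x) * y.
Proof. by apply: val_inj; exact: pres_scaleAl. Qed.

(** The structure map of Z over K, the same function as inside [relZ]; the name lets it carry a ring
    morphism structure. *)
Definition Zscalar (t : K) : Z := t *: (1 : Z).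

Lemma Zscalar_is_zmod_morphism : zmod_morphism Zscalar.
Proof. by move=> s t; rewrite /Zscalar scalerBl. Qed.

Lemma Zscalar_is_monoid_morphism : monoid_morphism Zscalar.
Proof.
split=> [|s t]; first exact: scale1r.
by rewrite /Zscalar -Zalg_scaleAl mul1r scalerA.
Qed.

HB.instance Definition _ :=
  GRing.isZmodMorphism.Build K Z Zscalar Zscalar_is_zmod_morphism.
HB.instance Definition _ :=
  GRing.isMonoidMorphism.Build K Z Zscalar Zscalar_is_monoid_morphism.

Lemma base_change_relZ j :
  base_change Zscalar (R j) = relZ R J0 j + scal I (Rbar R J0 j).
Proof. by rewrite subrK. Qed.

(** Only coefficients change, so [expr_below] carries over by conversion. *)
Definition expr_to_Z (e : expr I J K) : expr I J Z :=
  Expr (fun i => Zscalar (coef i)) (@lfac _ _ _ e) (@idx _ _ _ e)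
    (@rfac _ _ _ e).

Lemma composition_relZ (e : expr I J K) j k a c :
  composition R j k a c = eval_expr R e ->
  composition (relZ R J0) j k a c =
    obstacle R J0 e j k a c + eval_expr (relZ R J0) (expr_to_Z e).
Proof.
move=> /(congr1 (base_change Zscalar)).
rewrite /composition base_changeB !base_changeM !base_change_mon.
rewrite !base_change_relZ mulrDl mulrDr scal_mul mul_scal.
rewrite base_change_sum.
under eq_bigr => i _.
  rewrite base_changeZ !base_changeM !base_change_mon base_change_relZ.
  rewrite mulrDr mulrDl mul_scal -fscaleAl -monM scalerDr scalerA.
  rewrite /Zscalar -Zalg_scaleAl mul1r.
  over.
(* The equation is solved for the sum of the terms in [relZ]. What remains besides the composition
   over Z, namely the [Rbar] terms of both sides, is minus the obstacle. *)
rewrite big_split /= => /eqP; rewrite opprD addrACA -subr_eq => /eqP/esym eqZ.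
rewrite -/(eval_expr (relZ R J0) (expr_to_Z e)) in eqZ.
by rewrite eqZ -[Rbar _ _ j *: _ - _]opprB [RHS]addrC -[X in _ = X + _]addrA -opprD subrK.
Qed.

End ScalarsOfZ.

Theorem proposition1p5 (K : fieldType) (I : choiceType) (J : Type) (J0 : set J)
    (le : rel {fmonom I}) (R : J -> freeAlg K I) :
  admissible le ->
  (forall j, is_monic le (R j)) ->
  groebner_shirshov le (leads le R) R ->
  (groebner_shirshov le (leads le R) (relZ R J0) <->
   forall j k a b c, overlap (leads le R) j k a b c ->
     exists e : expr I J K,
       [/\ expr_below le (leads le R) (a * b * c)%M e,
           composition R j k a c = eval_expr R e &
           exists e' : expr I J (Zalg R J0),
             expr_below le (leads le R) (a * b * c)%M e' /\
             obstacle R J0 e j k a c = eval_expr (relZ R J0) e']).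
Proof.
move=> _ _ [minR compR]; split=> [[_ compZ] j k a b c ov | obsR].
  have [e [lt_e compRe]] := compR _ _ _ _ _ ov.
  have [e1 [lt_e1 compZe1]] := compZ _ _ _ _ _ ov.
  exists e; split=> //.
  have lt_eZ : expr_below le (leads le R) (a * b * c)%M (expr_to_Z R J0 e).
    exact: lt_e.
  (* The obstacle is the composition over Z minus the extended expression, hence the factor -1. *)
  have [e' [lt_e' eq_e']] := eval_expr_addZ (relZ R J0) (-1) lt_e1 lt_eZ.
  exists e'; split=> //.
  by rewrite -eq_e' -compZe1 (composition_relZ J0 compRe) scaleN1r addrK.
(* The subword condition is [minR] itself, since both presentations use the leading monomials of the
   [R j]. *)
split=> // j k a b c ov.
have [e [lt_e compRe [e' [lt_e' obs_e']]]] := obsR _ _ _ _ _ ov.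
have lt_eZ : expr_below le (leads le R) (a * b * c)%M (expr_to_Z R J0 e).
  exact: lt_e.
have [e2 [lt_e2 eq_e2]] := eval_expr_addZ (relZ R J0) 1 lt_e' lt_eZ.
exists e2; split=> //.
by rewrite (composition_relZ J0 compRe) obs_e' -eq_e2 scale1r.
Qed.
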